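(* The general solution of the nonlinear second order differential equation $$f'(u_t)(u_{tt}+a u_{xt})=B(x,t)+A(u)(u_t+a u_x)$$ is obtained by solving $$f'(u_t)(u_{tt}+a u_{xt})=H'(t)+K'(u)(u_t+a u_x),$$ where the functions $H$ and $K$ are the general solutions of $$H'(t)=B(x(t),t)\qquad\text{and}\qquad K'(u)=A(u).$$
   Context: Here $u$ is the unknown function of $(x,t)$, and $a=a(x,t)$, $B(x,t)$, $A(u)$ and $f$ are given functions. The function $x(t)$ is the solution of $\frac{dx(t)}{dt}=a(x(t),t)$, $x(0)=x_0$. The second displayed equation arises by taking $f(u_t)$ of the form $f(u_t)=H(t)+K(u)$ and differentiating along $x(t)$: $\frac{d}{dt}(f(u_t))=H'(t)+K'(u)(u_t+a u_x)$.
   Formalization: The equation is posed on an open region each of whose points lies on a solution curve x(t) with x(0)=x_0 that stays in the region; elsewhere H'(t)=B(x(t),t) is undefined (e.g. a=-x^2, xt≥1). A and B are assumed continuous and u is C^2. *)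

(* Defs.v *)
From Stdlib Require Import Reals.
From Coquelicot Require Import Coquelicot.
Open Scope R_scope.

(* An unknown u is written u x t: first argument the space variable x, second
   the time t. *)
Definition Dx (u : R -> R -> R) (x t : R) : R := Derive (fun y => u y t) x.
Definition Dt (u : R -> R -> R) (x t : R) : R := Derive (fun s => u x s) t.

(* Subscripts are read from left to right: u_xt = (u_x)_t. *)
Definition Dxt (u : R -> R -> R) : R -> R -> R := Dt (Dx u).
Definition Dtt (u : R -> R -> R) : R -> R -> R := Dt (Dt u).

(* [Derive] is a total operator, hence the separate existence clauses. *)
Definition C1_on (Omega : R * R -> Prop) (u : R -> R -> R) : Prop :=
  forall x t, Omega (x, t) ->
    ex_derive (fun y => u y t) x /\ ex_derive (fun s => u x s) t /\
    continuity_2d_pt (Dx u) x t /\ continuity_2d_pt (Dt u) x t.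

Definition C2_on (Omega : R * R -> Prop) (u : R -> R -> R) : Prop :=
  C1_on Omega u /\ C1_on Omega (Dx u) /\ C1_on Omega (Dt u).

(* The open interval with possibly infinite endpoints lo and hi. *)
Definition in_itv (lo hi : Rbar) (s : R) : Prop := Rbar_lt lo s /\ Rbar_lt s hi.

(* G solves G' = g on the interval.  The general solution of this equation is
   the class of all such G. *)
Definition antiderivative_on (lo hi : Rbar) (g G : R -> R) : Prop :=
  forall s, in_itv lo hi s -> is_derive G s (g s).

(* X is a solution, on an open time interval containing 0 and with graph in
   Omega, of X'(t) = a (X t) t, X 0 = x0. *)
Definition characteristic (Omega : R * R -> Prop) (a : R -> R -> R)
    (lo hi : Rbar) (x0 : R) (X : R -> R) : Prop :=
  in_itv lo hi 0 /\ X 0 = x0 /\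
  forall t, in_itv lo hi t -> Omega (X t, t) /\ is_derive X t (a (X t) t).

(* u is twice continuously differentiable on Omega, with values in the domain
   of A (an open interval) and with u_t taking values in the domain V of f. *)
Definition admissible (Omega : R * R -> Prop) (Alo Ahi : Rbar) (V : R -> Prop)
    (u : R -> R -> R) : Prop :=
  C2_on Omega u /\
  forall x t, Omega (x, t) -> in_itv Alo Ahi (u x t) /\ V (Dt u x t).

Definition solves_pde (Omega : R * R -> Prop) (a B : R -> R -> R)
    (A f : R -> R) (u : R -> R -> R) : Prop :=
  forall x t, Omega (x, t) ->
    Derive f (Dt u x t) * (Dtt u x t + a x t * Dxt u x t)
    = B x t + A (u x t) * (Dt u x t + a x t * Dx u x t).

(* H is a function of t alone, attached to the curve X, so the equation
   involving H is an equation at the points (X t, t). *)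
Definition solves_along (lo hi : Rbar) (X : R -> R) (a : R -> R -> R)
    (f H K : R -> R) (u : R -> R -> R) : Prop :=
  forall t, in_itv lo hi t ->
    Derive f (Dt u (X t) t) * (Dtt u (X t) t + a (X t) t * Dxt u (X t) t)
    = Derive H t
      + Derive K (u (X t) t) * (Dt u (X t) t + a (X t) t * Dx u (X t) t).

(* The relation f(u_t) = H(t) + K(u) along X, whose total t-derivative is the
   equation of [solves_along]. *)
Definition first_integral_along (lo hi : Rbar) (X : R -> R)
    (f H K : R -> R) (u : R -> R -> R) : Prop :=
  forall t, in_itv lo hi t -> f (Dt u (X t) t) = H t + K (u (X t) t).

(* Main.v *)
From Stdlib Require Import Reals Classical.
From Coquelicot Require Import Coquelicot.
Require Import Defs.
Open Scope R_scope.

(** Along a characteristic curve [X] the operator [w_t + a w_x] is the total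
    time derivative of [w (X t) t]; so the second order equation, read along
    [X], involves two total derivatives.

    With [w = u] the chain rule gives the derivative of [K (u (X t) t)] as
    [A u * (u_t + a u_x)].  With [w = u_t] it gives that of [f (u_t (X t) t)]
    as [f' (u_t) * (u_tt + a (u_t)_x)], and equality of the mixed partials of a
    [C^2] function turns [(u_t)_x] into the [u_xt] of the equation.  Hence the
    equation holds along [X] exactly when [f (u_t) - K (u)], as a function of
    time on [X], has derivative [B (X t) t], that is, when it is itself a possible
    choice of [H].  This gives the first integral
    [f (u_t) = H + K (u)]; no integration is needed for it, since [H] may be
    taken to be this very difference.

    The form with [H'] and [K'] is a pointwise rewriting of the equation at the
    points of the curve.  Since characteristics sweep [Omega], an identity at
    all points of all of them is an identity on [Omega].  Existence of [H] and
    [K] is the fundamental theorem of calculus on an open interval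
    ([antiderivative_exists]); it is what keeps the form quantified over all
    [H] from being vacuous. *)

Lemma in_itv_open (lo hi : Rbar) : open (in_itv lo hi).
Proof. exact (open_and _ _ (open_Rbar_gt lo) (open_Rbar_lt hi)). Qed.

Lemma in_itv_convex (lo hi : Rbar) (x y z : R) :
  in_itv lo hi x -> in_itv lo hi y -> Rmin x y <= z <= Rmax x y ->
  in_itv lo hi z.
Proof.
  intros [lox xhi] [loy yhi] [xz zx]; split.
  - apply Rbar_lt_le_trans with (Rmin x y); [ | exact xz].
    unfold Rmin; destruct (Rle_dec x y); assumption.
  - apply Rbar_le_lt_trans with (Rmax x y); [exact zx | ].
    unfold Rmax; destruct (Rle_dec x y); assumption.
Qed.

Lemma antiderivative_exists (lo hi : Rbar) (g : R -> R) :
  (forall s, in_itv lo hi s -> continuous g s) ->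
  exists G, antiderivative_on lo hi g G.
Proof.
  intros g_cont.
  (* The integral needs a base point in the interval, which may be empty. *)
  destruct (classic (exists c, in_itv lo hi c)) as [[c c_in] | empty].
  - exists (RInt g c); intros s s_in.
    apply is_derive_RInt with c; [ | now apply g_cont].
    apply filter_imp with (in_itv lo hi); [ | now apply in_itv_open].
    intros b b_in; apply (RInt_correct g), (ex_RInt_continuous g).
    intros z z_in; apply g_cont; now apply in_itv_convex with c b.
  - exists g; intros s s_in; destruct empty; now exists s.
Qed.

Lemma continuous_along (w : R -> R -> R) (X : R -> R) (t : R) :
  continuity_2d_pt w (X t) t -> continuous X t ->
  continuous (fun s => w (X s) s) t.
Proof.
  intros w_cont X_cont.
  apply (continuous_comp_2 X (fun s => s) w); [exact X_cont | apply continuous_id | ].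
  now apply continuity_2d_pt_filterlim.
Qed.

Lemma C1_on_differentiable (Omega : R * R -> Prop) (w : R -> R -> R) (x t : R) :
  open Omega -> C1_on Omega w -> Omega (x, t) ->
  differentiable_pt_lim w x t (Dx w x t) (Dt w x t).
Proof.
  intros Omega_open w_C1 xt_in.
  destruct (w_C1 x t xt_in) as [_ [w_t [w_x_cont _]]].
  apply filterdiff_differentiable_pt_lim, (is_derive_filterdiff w x t (Dx w)).
  - apply filter_imp with Omega; [ | now apply Omega_open].
    intros [y s] ys_in; apply Derive_correct; now apply w_C1.
  - now apply Derive_correct.
  - now apply continuity_2d_pt_filterlim.
Qed.

Lemma is_derive_along (Omega : R * R -> Prop) (w : R -> R -> R) (X : R -> R)
    (t v : R) :
  open Omega -> C1_on Omega w -> Omega (X t, t) -> is_derive X t v ->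
  is_derive (fun s => w (X s) s) t (Dt w (X t) t + v * Dx w (X t) t).
Proof.
  intros Omega_open w_C1 Xt_in X_der.
  replace (Dt w (X t) t + v * Dx w (X t) t)
    with (Dx w (X t) t * v + Dt w (X t) t * 1) by ring.
  apply is_derive_Reals.
  apply (derivable_pt_lim_comp_2d w X (fun s => s)).
  - now apply C1_on_differentiable with Omega.
  - now apply is_derive_Reals.
  - apply derivable_pt_lim_id.
Qed.

Lemma C2_on_mixed_partials (Omega : R * R -> Prop) (u : R -> R -> R) (x t : R) :
  open Omega -> C2_on Omega u -> Omega (x, t) -> Dx (Dt u) x t = Dxt u x t.
Proof.
  intros Omega_open [u_C1 [ux_C1 ut_C1]] xt_in.
  apply Schwarz.
  - apply locally_2d_locally, filter_imp with Omega; [ | now apply Omega_open].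
    intros [y s] ys_in; simpl.
    destruct (u_C1 y s ys_in) as [u_x [u_t _]].
    destruct (ux_C1 y s ys_in) as [_ [u_xt _]].
    destruct (ut_C1 y s ys_in) as [u_tx _].
    repeat split; assumption.
  - apply (ut_C1 x t xt_in).
  - apply (ux_C1 x t xt_in).
Qed.

(** The commutation of mixed partials enters here: differentiating [u_t] along
    the curve yields [(u_t)_x], whereas the equation contains [(u_x)_t]. *)
Lemma is_derive_f_ut_along (Omega : R * R -> Prop) (u : R -> R -> R)
    (f X : R -> R) (t v : R) :
  open Omega -> C2_on Omega u -> Omega (X t, t) -> is_derive X t v ->
  ex_derive f (Dt u (X t) t) ->
  is_derive (fun s => f (Dt u (X s) s)) t
    (Derive f (Dt u (X t) t) * (Dtt u (X t) t + v * Dxt u (X t) t)).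
Proof.
  intros Omega_open u_C2 Xt_in X_der f_der.
  rewrite <- (C2_on_mixed_partials Omega) by assumption.
  rewrite Rmult_comm.
  apply (is_derive_comp f (fun s => Dt u (X s) s)).
  - now apply Derive_correct.
  - apply (is_derive_along Omega (Dt u)); try assumption; apply u_C2.
Qed.

Theorem proposition4
  (Omega : R * R -> Prop) (a B : R -> R -> R)
  (Alo Ahi : Rbar) (A : R -> R) (V : R -> Prop) (f : R -> R)
  (Omega_open : open Omega)
  (B_cont : forall x t, Omega (x, t) -> continuity_2d_pt B x t)
  (A_cont : forall s, in_itv Alo Ahi s -> continuous A s)
  (V_open : open V)
  (f_diff : forall p, V p -> ex_derive f p)
  (Omega_swept : forall x t, Omega (x, t) ->
     exists (lo hi : Rbar) (x0 : R) (X : R -> R),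
       characteristic Omega a lo hi x0 X /\ in_itv lo hi t /\ X t = x) :
  (exists K, antiderivative_on Alo Ahi A K) /\
  (forall lo hi x0 X, characteristic Omega a lo hi x0 X ->
     exists H, antiderivative_on lo hi (fun t => B (X t) t) H) /\
  forall u, admissible Omega Alo Ahi V u ->
  forall K, antiderivative_on Alo Ahi A K ->
    (solves_pde Omega a B A f u <->
     forall lo hi x0 X, characteristic Omega a lo hi x0 X ->
     forall H, antiderivative_on lo hi (fun t => B (X t) t) H ->
       solves_along lo hi X a f H K u) /\
    (solves_pde Omega a B A f u <->
     forall lo hi x0 X, characteristic Omega a lo hi x0 X ->
     exists H, antiderivative_on lo hi (fun t => B (X t) t) H /\
       first_integral_along lo hi X f H K u).
Proof.
  assert (H_exists : forall lo hi x0 X, characteristic Omega a lo hi x0 X ->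
     exists H, antiderivative_on lo hi (fun t => B (X t) t) H).
  { intros lo hi x0 X [_ [_ X_char]].
    apply antiderivative_exists; intros t t_in.
    destruct (X_char t t_in) as [Xt_in X_der].
    apply (continuous_along B); [now apply B_cont | ].
    apply (ex_derive_continuous X); eexists; exact X_der. }
  split; [now apply antiderivative_exists | split; [exact H_exists | ]].
  intros u [u_C2 u_dom] K K_anti.
  assert (der_Ku : forall lo hi x0 X t, characteristic Omega a lo hi x0 X ->
     in_itv lo hi t ->
     is_derive (fun s => K (u (X s) s)) t
       (A (u (X t) t) * (Dt u (X t) t + a (X t) t * Dx u (X t) t))).
  { intros lo hi x0 X t [_ [_ X_char]] t_in.
    destruct (X_char t t_in) as [Xt_in X_der].
    rewrite Rmult_comm.
    apply (is_derive_comp K (fun s => u (X s) s)).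
    - apply K_anti, (u_dom _ _ Xt_in).
    - apply (is_derive_along Omega u); try assumption; apply u_C2. }
  assert (der_fut : forall lo hi x0 X t, characteristic Omega a lo hi x0 X ->
     in_itv lo hi t ->
     is_derive (fun s => f (Dt u (X s) s)) t
       (Derive f (Dt u (X t) t)
        * (Dtt u (X t) t + a (X t) t * Dxt u (X t) t))).
  { intros lo hi x0 X t [_ [_ X_char]] t_in.
    destruct (X_char t t_in) as [Xt_in X_der].
    apply (is_derive_f_ut_along Omega); try assumption.
    apply f_diff, (u_dom _ _ Xt_in). }
  split; split.
  - intros pde lo hi x0 X [_ [_ X_char]] H H_anti t t_in.
    destruct (X_char t t_in) as [Xt_in _].
    rewrite (is_derive_unique _ _ _ (H_anti t t_in)).
    rewrite (is_derive_unique _ _ _ (K_anti _ (proj1 (u_dom _ _ Xt_in)))).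
    now apply pde.
  - intros along x t xt_in.
    destruct (Omega_swept x t xt_in) as (lo & hi & x0 & X & X_char & t_in & <-).
    destruct (H_exists lo hi x0 X X_char) as [H H_anti].
    generalize (along lo hi x0 X X_char H H_anti t t_in).
    rewrite (is_derive_unique _ _ _ (H_anti t t_in)).
    now rewrite (is_derive_unique _ _ _ (K_anti _ (proj1 (u_dom _ _ xt_in)))).
  - intros pde lo hi x0 X X_char.
    exists (fun t => f (Dt u (X t) t) - K (u (X t) t)); split;
      [ | intros t _; ring].
    intros t t_in.
    destruct (proj2 (proj2 X_char) t t_in) as [Xt_in _].
    generalize (is_derive_minus _ _ _ _ _
      (der_fut lo hi x0 X t X_char t_in) (der_Ku lo hi x0 X t X_char t_in)).
    rewrite (pde _ _ Xt_in).
    unfold minus, plus, opp; simpl; intros der.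
    replace (B (X t) t) with
      (B (X t) t + A (u (X t) t) * (Dt u (X t) t + a (X t) t * Dx u (X t) t)
       + - (A (u (X t) t) * (Dt u (X t) t + a (X t) t * Dx u (X t) t)))
      by ring.
    exact der.
  - intros first x t xt_in.
    destruct (Omega_swept x t xt_in) as (lo & hi & x0 & X & X_char & t_in & <-).
    destruct (first lo hi x0 X X_char) as (H & H_anti & H_first).
    generalize (is_derive_unique _ _ _ (der_fut lo hi x0 X t X_char t_in)).
    intros <-; apply is_derive_unique.
    apply is_derive_ext_loc with (fun s => H s + K (u (X s) s)).
    + apply filter_imp with (in_itv lo hi); [ | now apply in_itv_open].
      intros s s_in; symmetry; now apply H_first.
    + apply (is_derive_plus H (fun s => K (u (X s) s)));
        [now apply H_anti | now apply der_Ku with lo hi x0].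
Qed.
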